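(* Let $A\in\mathbb{R}^{n\times n}$ and consider the discrete-time linear dynamical system $x_{k+1}=Ax_k$. Suppose there exists a positive definite polynomial $V:\mathbb{R}^n\to\mathbb{R}$ such that the polynomial $V(x)-V(Ax)$ is positive definite and a sum of squares. Then $V$ is a sum of squares.
   Context: A function $V:\mathbb{R}^n\to\mathbb{R}$ is positive definite if $V(x)>0$ for all $x\neq 0$. A polynomial is a sum of squares (sos) if it equals $\sum_i q_i^2$ for finitely many real polynomials $q_i$. *)

(* Defs.v *)
From HB Require Import structures.
From mathcomp Require Import all_boot all_order all_algebra.
From mathcomp Require Import mpoly.
From mathcomp Require Import reals.

Set Implicit Arguments.
Unset Strict Implicit.
Unset Printing Implicit Defensive.

Import Order.TTheory GRing.Theory Num.Theory.

Local Open Scope ring_scope.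

Definition mpoly_fun (R : realType) (n : nat) (p : {mpoly R[n]}) :
    'cV[R]_n -> R :=
  fun x => p.@[fun i => x i 0].

(* Only nonzero points are constrained: the value at the origin is free. *)
Definition positive_definite (R : realType) (n : nat) (f : 'cV[R]_n -> R) :
    Prop :=
  forall x : 'cV[R]_n, x != 0 -> 0 < f x.

Definition is_sos (R : realType) (n : nat) (p : {mpoly R[n]}) : Prop :=
  exists s : seq {mpoly R[n]}, p = \sum_(q <- s) q ^+ 2.

(* The polynomial p(A x): the i-th variable is replaced by the i-th coordinate
   of A x, see mpoly_fun_lin. *)
Definition mpoly_lin (R : realType) (n : nat) (A : 'M[R]_n)
    (p : {mpoly R[n]}) : {mpoly R[n]} :=
  p \mPo [tuple \sum_(j < n) A i j *: 'X_j | i < n].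

Lemma mpoly_fun_lin (R : realType) (n : nat) (A : 'M[R]_n) (p : {mpoly R[n]})
    (x : 'cV[R]_n) :
  mpoly_fun (mpoly_lin A p) x = mpoly_fun p (A *m x).
Proof.
rewrite /mpoly_fun /mpoly_lin comp_mpoly_meval; apply: meval_eq => i.
rewrite tnth_mktuple raddf_sum /= mxE; apply: eq_bigr => j _.
by rewrite mevalZ mevalXU.
Qed.

(* Main.v *)
Require Import Defs.
From mathcomp Require Import all_boot all_order all_algebra.
From mathcomp Require Import mpoly.
From mathcomp Require Import reals.
From mathcomp Require Import ring lra.
From mathcomp Require Import boolp classical_sets topology normedtype.
From mathcomp Require Import sequences derive realfun.

(** Write [W x = V x - V (A x)], a sum of squares. The partial sums of the series
    [S x = W x + W (A x) + W (A^2 x) + ...] telescope to [V x - V (A^K x)], hence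
    are at most [V x]. They are sums of squares of bounded degree, so they are
    given by positive semidefinite Gram matrices of a fixed size. These matrices
    increase, and the bound at every point [x] bounds them, because the vectors of
    monomial values span; their limit is positive semidefinite, and a positive
    semidefinite matrix splits into rank one squares. So [S] is a polynomial and
    a sum of squares ([sos_series_limit], [orbit_sos]).

    It remains to see that [V - S] is a nonnegative constant. As
    [S (A x) = S x - W x], the polynomial [V - S] is invariant under [A]. Also [S]
    vanishes at the origin, is positive elsewhere, and strictly decreases along
    nonzero points, so it is a Lyapunov function; since the dynamics are linear,
    every orbit comes arbitrarily close to [0] even if [S] fails to grow at
    infinity ([lyapunov_linear]). By continuity the invariant polynomial [V - S]
    is equal to its value at [0], which is [V 0], and [V 0] is nonnegative as a
    limit of positive values. (The sum [S] is needed here: [V] may be positive at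
    the origin, and then it is no Lyapunov function itself.) Adding the square of
    the square root of [V 0] to [S] gives [V]. *)

Set Implicit Arguments.
Unset Strict Implicit.
Unset Printing Implicit Defensive.

Import Order.TTheory GRing.Theory Num.Theory.
Import numFieldNormedType.Exports.

Local Open Scope classical_set_scope.
Local Open Scope ring_scope.

(** * Polynomials are determined by their values *)

Lemma poly_nonroot (R : numDomainType) (p : {poly R}) :
  p != 0 -> exists t, p.[t] != 0.
Proof.
move=> p0; have inj : injective (fun k : nat => k%:R : R).
  by move=> i j /eqP; rewrite eqr_nat => /eqP.
set rs := [seq k%:R : R | k <- iota 0 (size p)].
have [allr|/allPn[t _ nr]] := boolP (all (root p) rs); last by exists t.
have := max_poly_roots p0 allr.
by rewrite map_inj_uniq // iota_uniq size_map size_iota ltnn => /(_ isT).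
Qed.

(** Read as a univariate polynomial in the last variable, evaluation splits into
    evaluating the coefficients and then the last variable; this drives the
    induction on the number of variables in [meval_neq0]. *)
Lemma meval_muni (R : numDomainType) (n : nat) (p : {mpoly R[n.+1]})
    (v : 'I_n -> R) (t : R) :
  (map_poly (meval v) (muni p)).[t]
  = p.@[fun i => if unlift ord_max i is Some j then v j else t].
Proof.
rewrite muniE mevalE raddf_sum /= horner_sum; apply: eq_bigr => m _.
rewrite map_polyZ map_polyXn hornerZ hornerXn /= mevalZ mevalX -mulrA.
congr (_ * _); rewrite big_ord_recr /= unlift_none; congr (_ * _).
apply: eq_bigr => i _; rewrite mnmE.
have -> : widen_ord (leqnSn n) i = lift ord_max i.
  by apply: val_inj => /=; rewrite /bump leqNgt ltn_ord.
by rewrite liftK.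
Qed.

Lemma muni_neq0 (R : numDomainType) (n : nat) (p : {mpoly R[n.+1]}) :
  p != 0 -> muni p != 0.
Proof.
pose res (m : 'X_{1..n.+1}) : 'X_{1..n} :=
  [multinom m (widen_ord (leqnSn n) i) | i < n].
have res_inj m1 m2 : res m1 = res m2 -> m1 ord_max = m2 ord_max -> m1 = m2.
  move=> /mnmP eq12 eqmax; apply/mnmP => i.
  case: (unliftP ord_max i) => [j ->|-> //].
  have := eq12 j; rewrite !mnmE.
  have -> // : widen_ord (leqnSn n) j = lift ord_max j.
  by apply: val_inj => /=; rewrite /bump leqNgt ltn_ord.
apply: contra_neq => mu0; apply/mpolyP => m; rewrite mcoeff0.
have [m_p|/memN_msupp_eq0 //] := boolP (m \in msupp p).
have := congr1 (fun q : {poly {mpoly R[n]}} => (q`_(m ord_max))@_(res m)) mu0.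
rewrite muniE coef0 mcoeff0 coef_sum raddf_sum /= (bigD1_seq m) //=.
rewrite coefZ coefXn eqxx mulr1 mcoeffZ mcoeffX eqxx mulr1.
rewrite big1 ?addr0 // => m2 m2m; rewrite coefZ coefXn.
have [eqm|_] := eqVneq; last by rewrite mulr0 mcoeff0.
rewrite mulr1 mcoeffZ mcoeffX; have [eqr|_] := eqVneq; last by rewrite mulr0.
by case/eqP: m2m; apply: res_inj.
Qed.

(** Induction on the number of variables: some point does not kill the leading
    coefficient of [muni p], and the univariate polynomial that remains has only
    finitely many roots. *)
Lemma meval_neq0 (R : numDomainType) (n : nat) (p : {mpoly R[n]}) :
  p != 0 -> exists v, p.@[v] != 0.
Proof.
elim: n p => [|n IHn] p p0.
  exists (fun=> 0); apply: contra_neq p0.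
  by rewrite (nvar0_mpolyC p) mevalC => ->.
have /IHn [v] : lead_coef (muni p) != 0 by rewrite lead_coef_eq0 muni_neq0.
rewrite lead_coefE => pv0.
have /poly_nonroot [t] : map_poly (meval v) (muni p) != 0.
  apply: contra_neq pv0 => mp0.
  have := congr1 (fun q : {poly R} => q`_(size (muni p)).-1) mp0.
  by rewrite coef_map coef0.
rewrite meval_muni => pvt.
by exists (fun i => if unlift ord_max i is Some j then v j else t).
Qed.

Lemma mpoly_eq_fun (R : realType) (n : nat) (p q : {mpoly R[n]}) :
  (forall x, mpoly_fun p x = mpoly_fun q x) -> p = q.
Proof.
move=> pq; apply/eqP; rewrite -subr_eq0; apply/negPn/negP => /meval_neq0[v].
have := pq (\col_i v i); rewrite /mpoly_fun.
have vE : (fun i => (\col_i v i) i 0) =1 v by move=> i; rewrite mxE.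
by rewrite !(meval_eq _ vE) mevalB => ->; rewrite subrr eqxx.
Qed.

(** * Linear changes of variables do not raise the degree *)

Lemma dhomog_msize_le (R : nzRingType) (n d : nat) (p : {mpoly R[n]}) :
  p \is d.-homog -> (msize p <= d.+1)%N.
Proof.
move=> /dhomogP homp; rewrite msizeE; apply/bigmax_leqP_seq => m m_p _.
by rewrite ltnS homp.
Qed.

Lemma msize_lin (R : realType) (n : nat) (A : 'M[R]_n) (p : {mpoly R[n]}) :
  (msize (mpoly_lin A p) <= msize p)%N.
Proof.
have deg1 i : (\sum_(j < n) A i j *: 'X_j : {mpoly R[n]}) \is 1.-homog.
  by apply: rpred_sum => j _; apply: dhomogZ; rewrite dhomogX /= mdeg1.
rewrite /mpoly_lin comp_mpolyE; apply: leq_trans (mmeasure_sum _ _ _ _) _.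
apply/bigmax_leqP_seq => m m_p _.
apply: leq_trans (msizeZ_le _ _) (leq_trans _ (msize_mdeg_lt m_p)).
apply: dhomog_msize_le; rewrite mdegE.
elim/big_ind2: _ => [|k1 q1 k2 q2 h1 h2|i _]; first exact: dhomog1.
  exact: dhomogM.
by rewrite tnth_mktuple; have := dhomogMn (m i) (deg1 i); rewrite mul1n.
Qed.

(** * Positive semidefinite matrices are sums of rank one squares *)

Section Bilinear.
Variables (R : realType) (N : nat).
Implicit Types (G : 'M[R]_N) (u v w : 'rV[R]_N).

Lemma mx11_tr (M : 'M[R]_1) : M 0 0 = M^T 0 0.
Proof. by rewrite mxE. Qed.

Definition bform G u w : R := (u *m G *m w^T) 0 0.

Lemma bformDl G u v w : bform G (u + v) w = bform G u w + bform G v w.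
Proof. by rewrite /bform !mulmxDl mxE. Qed.

Lemma bformDr G u v w : bform G u (v + w) = bform G u v + bform G u w.
Proof. by rewrite /bform linearD mulmxDr mxE. Qed.

Lemma bformZl G t u w : bform G (t *: u) w = t * bform G u w.
Proof. by rewrite /bform -!scalemxAl mxE. Qed.

Lemma bformZr G t u w : bform G u (t *: w) = t * bform G u w.
Proof. by rewrite /bform linearZ /= -scalemxAr mxE. Qed.

Lemma bform_addmx G H u w : bform (G + H) u w = bform G u w + bform H u w.
Proof. by rewrite /bform mulmxDr mulmxDl mxE. Qed.

Lemma bform_oppmx G u w : bform (- G) u w = - bform G u w.
Proof. by rewrite /bform mulmxN mulNmx mxE. Qed.

Lemma bform_scalemx t G u w : bform (t *: G) u w = t * bform G u w.
Proof. by rewrite /bform -scalemxAr -scalemxAl mxE. Qed.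

Lemma bform_rank1 v u w :
  bform (v^T *m v) u w = (u *m v^T) 0 0 * (w *m v^T) 0 0.
Proof.
rewrite /bform mulmxA -mulmxA mxE big_ord1; congr (_ * _).
by rewrite mx11_tr trmx_mul trmxK.
Qed.

Lemma bform_delta G i j : bform G (delta_mx 0 i) (delta_mx 0 j) = G i j.
Proof. by rewrite /bform -rowE trmx_delta -colE !mxE. Qed.

Lemma bform_deltal G i u : bform G (delta_mx 0 i) u = (u *m (row i G)^T) 0 0.
Proof. by rewrite /bform -rowE mx11_tr trmx_mul trmxK. Qed.

Lemma bformC G u w : G^T = G -> bform G u w = bform G w u.
Proof.
by move=> sG; rewrite /bform mx11_tr !trmx_mul trmxK sG mulmxA.
Qed.

Lemma bformE G u w : bform G u w = \sum_i \sum_j G i j * (u 0 i * w 0 j).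
Proof.
rewrite /bform mxE exchange_big; apply: eq_bigr => j _ /=.
by rewrite !mxE big_distrl; apply: eq_bigr => i _ /=; ring.
Qed.

Definition psd G : Prop := G^T = G /\ forall u, 0 <= bform G u u.

(** With a zero diagonal, the form takes the values [2 * G i j] and [- 2 * G i j]
    at the sum and at the difference of two basis vectors. *)
Lemma psd_diag0 G : psd G -> (forall i, G i i = 0) -> G = 0.
Proof.
move=> [sG pG] dG; apply/matrixP => i j; rewrite mxE.
have := pG (delta_mx 0 i + delta_mx 0 j).
have := pG (delta_mx 0 i + (-1) *: delta_mx 0 j).
have sij : G j i = G i j by rewrite -{1}sG mxE.
rewrite !(bformDl, bformDr, bformZl, bformZr, bform_delta) !dG sij; lra.
Qed.

(** One step of Cholesky elimination. Completing the square: the form of [H] at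
    [u] is the form of [G] at [u] shifted along the [i]-th basis vector to the
    minimum. *)
Lemma psd_eliminate G i (H := G - (G i i)^-1 *: ((row i G)^T *m row i G)) :
  psd G -> G i i != 0 -> psd H.
Proof.
move=> [sG pG] Gi0; split.
  by rewrite /H linearB linearZ /= trmx_mul trmxK sG.
move=> u; pose t := (u *m (row i G)^T) 0 0 / G i i.
have := pG (u + (- t) *: delta_mx 0 i).
rewrite !(bformDl, bformDr, bformZl, bformZr, bform_delta).
rewrite (bformC u _ sG) bform_deltal.
congr (0 <= _); rewrite /H bform_addmx bform_oppmx bform_scalemx bform_rank1 /t.
by field.
Qed.

(** Elimination strictly decreases the number of nonzero diagonal entries: the
    pivot vanishes, and an entry that is zero can only decrease, hence stays
    zero. *)
Lemma psd_sum_rank1 G : psd G ->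
  exists s : seq 'rV[R]_N, G = \sum_(v <- s) v^T *m v.
Proof.
have [k] := ubnP #|[pred i | G i i != 0]|.
elim: k G => // k IHk G leGk psdG.
have [/existsP[i Gi0]|/existsPn dG] := boolP [exists i, G i i != 0]; last first.
  exists [::]; rewrite big_nil; apply: psd_diag0 => // i.
  by apply/eqP/negPn/dG.
set H := G - (G i i)^-1 *: ((row i G)^T *m row i G).
have psdH : psd H by apply: psd_eliminate.
have dge0 (K : 'M[R]_N) j : psd K -> 0 <= K j j.
  by move=> [_ /(_ (delta_mx 0 j))]; rewrite bform_delta.
have HE j : H j j = G j j - (G i i)^-1 * G i j ^+ 2.
  by rewrite /H !mxE big_ord1 !mxE expr2.
have Gi_gt0 : 0 < G i i by rewrite lt_neqAle eq_sym Gi0 dge0.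
have [|s Hs] := IHk H _ psdH.
  rewrite -ltnS; apply: leq_ltn_trans leGk; apply: proper_card.
  apply/properP; split; last first.
    exists i; rewrite !inE ?Gi0 //= HE negbK; apply/eqP; by field.
  apply/fintype.subsetP => j; rewrite !inE; apply: contra_neq => Gj0.
  apply/eqP; rewrite eq_le dge0 // andbT HE Gj0 sub0r oppr_le0.
  by rewrite mulr_ge0 ?sqr_ge0 // invr_ge0 ltW.
exists (Num.sqrt (G i i)^-1 *: row i G :: s).
rewrite big_cons -Hs -scalemxAr linearZ /= -scalemxAl scalerA -expr2.
by rewrite sqr_sqrtr ?invr_ge0 ?ltW // addrC subrK.
Qed.

End Bilinear.

(** * Gram matrices and limits of sums of squares *)

Section Gram.
Variables (R : realType) (n d : nat).
Local Notation N := #|{: 'X_{1..n < d}}|.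
Implicit Types (x : 'I_n -> R) (u v : 'rV[R]_N) (G : 'M[R]_N).

Definition expo (i : 'I_N) : 'X_{1..n} := bmnm (enum_val i).

Lemma expo_inj : injective expo.
Proof. by move=> i j /val_inj/enum_val_inj. Qed.

Definition monom_row x : 'rV[R]_N := \row_i ('X_[expo i] : {mpoly R[n]}).@[x].

Definition coef_row (p : {mpoly R[n]}) : 'rV[R]_N := \row_i p@_(expo i).

Definition row_poly v : {mpoly R[n]} := \sum_i v 0 i *: 'X_[expo i].

Definition gram_poly G : {mpoly R[n]} :=
  \sum_i \sum_j G i j *: ('X_[expo i] * 'X_[expo j]).

Lemma coef_rowK p : (msize p <= d)%N -> row_poly (coef_row p) = p.
Proof.
move=> le_pd; rewrite [RHS](mpolywE le_pd) /row_poly.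
rewrite [RHS](reindex _ (onW_bij _ (enum_val_bij _))) /=.
by apply: eq_bigr => i _; rewrite mxE.
Qed.

Lemma row_polyK v : coef_row (row_poly v) = v.
Proof.
apply/rowP => i; rewrite mxE raddf_sum /= (bigD1 i) //= mcoeffZ mcoeffX eqxx.
rewrite mulr1 big1 ?addr0 // => j ji; rewrite mcoeffZ mcoeffX.
by rewrite (inj_eq expo_inj) (negPf ji) mulr0.
Qed.

Lemma row_poly_eq0 v : row_poly v = 0 -> v = 0.
Proof.
by move=> v0; rewrite -(row_polyK v) v0; apply/rowP => i; rewrite !mxE mcoeff0.
Qed.

Lemma meval_row_poly v x : (row_poly v).@[x] = (monom_row x *m v^T) 0 0.
Proof.
rewrite raddf_sum mxE; apply: eq_bigr => i _ /=.
by rewrite mevalZ !mxE mulrC.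
Qed.

Lemma meval_gram_poly G x :
  (gram_poly G).@[x] = bform G (monom_row x) (monom_row x).
Proof.
rewrite bformE raddf_sum; apply: eq_bigr => i _ /=; rewrite raddf_sum.
by apply: eq_bigr => j _ /=; rewrite mevalZ mevalM !mxE.
Qed.

Lemma gram_polyD G H : gram_poly (G + H) = gram_poly G + gram_poly H.
Proof.
rewrite -big_split; apply: eq_bigr => i _; rewrite -big_split.
by apply: eq_bigr => j _ /=; rewrite mxE scalerDl.
Qed.

Lemma gram_poly0 : gram_poly 0 = 0.
Proof. by apply: big1 => i _; apply: big1 => j _; rewrite mxE scale0r. Qed.

Lemma gram_poly_rank1 v : gram_poly (v^T *m v) = row_poly v ^+ 2.
Proof.
rewrite expr2 big_distrl; apply: eq_bigr => i _ /=.
rewrite big_distrr; apply: eq_bigr => j _ /=.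
by rewrite mxE big_ord1 mxE -scalerAl -scalerAr scalerA.
Qed.

Lemma psd_gram_sos G : psd G -> is_sos (gram_poly G).
Proof.
case/psd_sum_rank1 => s ->; exists [seq row_poly v | v <- s].
rewrite big_map (big_morph _ gram_polyD gram_poly0).
by apply: eq_bigr => v _; rewrite gram_poly_rank1.
Qed.

(** The vectors of monomial values span: a functional vanishing on all of them is
    the coefficient vector of a polynomial with no nonzero value. A subspace is
    enlarged by one such vector at a time, which is an induction on the rank. *)
Lemma monom_row_ind (B : 'rV[R]_N -> Prop) :
  (forall u v, B u -> B v -> B (u + v)) -> (forall t u, B u -> B (t *: u)) ->
  (forall x, B (monom_row x)) -> forall u, B u.
Proof.
move=> BD BZ Bm.
have B0 : B 0 by rewrite -(scale0r (monom_row (fun=> 0))); apply/BZ/Bm.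
suff /(_ N (leqnn N)) [M [rkM BM]] : forall k, (k <= N)%N ->
    exists M : 'M[R]_N, (k <= \rank M)%N /\ forall u, (u <= M)%MS -> B u.
  move=> u; apply: BM; apply: submx_full.
  by rewrite row_full_unit -row_free_unit /row_free eqn_leq rank_leq_row.
elim=> [_|k IHk lt_kN].
  by exists 0; split=> // u; rewrite submx0 => /eqP ->.
have [M [rkM BM]] := IHk (ltnW lt_kN).
have [|le_rk] := leqP k.+1 (\rank M); first by exists M.
(* A row in this kernel is orthogonal to the span of [M]. *)
have /rowV0Pn[v] : (kermx M^T != 0)%MS.
  rewrite -mxrank_eq0 mxrank_ker mxrank_tr subn_eq0 -ltnNge.
  exact: leq_ltn_trans lt_kN.
rewrite sub_kermx => /eqP vM v0.
have /meval_neq0[x] : row_poly v != 0.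
  by apply: contra_neq v0; apply: row_poly_eq0.
rewrite meval_row_poly => xv0.
exists (M + monom_row x)%MS; split; last first.
  move=> u /sub_addsmxP[[D E] /= ->]; apply: BD; first by apply/BM/submxMl.
  by rewrite [E]mx11_scalar mul_scalar_mx; apply/BZ/Bm.
apply: leq_ltn_trans rkM _; rewrite ltn_neqAle mxrankS ?addsmxSl // andbT.
apply: contra xv0; rewrite (mxrank_leqif_sup (addsmxSl M (monom_row x))).
rewrite addsmx_sub submx_refl /= => /submxP[D ->].
by rewrite -mulmxA -[M]trmxK -trmx_mul vM trmx0 mulmx0 mxE.
Qed.

(** The partial sums are monotone as quadratic forms. Being bounded on a spanning
    set, they are bounded everywhere, so each value of the quadratic form
    converges; polarization recovers the entries of the limit matrix. *)
Lemma psd_series_cvg (P : nat -> 'M[R]_N) : (forall k, psd (P k)) ->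
  (forall x, exists C, forall K,
     bform (\sum_(k < K) P k) (monom_row x) (monom_row x) <= C) ->
  exists2 G, psd G & forall u w,
    (fun K => bform (\sum_(k < K) P k) u w) @ \oo --> bform G u w.
Proof.
move=> psdP bndP; pose S K := \sum_(k < K) P k.
have SS K : S K.+1 = S K + P K by rewrite /S big_ord_recr.
have psdS K : psd (S K).
  elim: K => [|K [sS pS]].
    rewrite /S big_ord0; split=> [|u]; first by rewrite trmx0.
    by rewrite /bform mulmx0 mul0mx mxE.
  have [sP pP] := psdP K; split; first by rewrite SS linearD /= sS sP.
  by move=> u; rewrite SS bform_addmx addr_ge0.
have bnd u : exists C, forall K, bform (S K) u u <= C.
  elim/monom_row_ind: u => [u v [C1 le1] [C2 le2]|t u [C leC]|x];
    last exact: bndP.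
    exists (2 * C1 + 2 * C2) => K; have [sS pS] := psdS K.
    (* parallelogram law: the form at [u - v] is nonnegative *)
    have := pS (u + (-1) *: v); have := le1 K; have := le2 K.
    rewrite !(bformDl, bformDr, bformZl, bformZr) (bformC v u sS); lra.
  exists (t ^+ 2 * C) => K; rewrite bformZl bformZr mulrA -expr2.
  by rewrite ler_wpM2l ?sqr_ge0.
have cvgq u : cvgn (fun K => bform (S K) u u).
  apply: nondecreasing_is_cvgn.
    apply/nondecreasing_seqP => K; rewrite SS bform_addmx lerDl.
    by have [_] := psdP K.
  by have [C leC] := bnd u; exists C => _ [K _ <-].
pose e i : 'rV[R]_N := delta_mx 0 i.
pose l u : R := limn (fun K => bform (S K) u u).
pose G : 'M[R]_N := \matrix_(i, j) (2^-1 * (l (e i + e j) - l (e i) - l (e j))).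
have GE i j : G i j = 2^-1 * (l (e i + e j) - l (e i) - l (e j)) by rewrite mxE.
have cvgG i j : (fun K => S K i j) @ \oo --> G i j.
  have -> : (fun K => S K i j) = (fun K =>
      2^-1 * (bform (S K) (e i + e j) (e i + e j)
              - bform (S K) (e i) (e i) - bform (S K) (e j) (e j))).
    apply/funext => K; have [sS _] := psdS K.
    have sji : S K j i = S K i j by rewrite -{1}sS mxE.
    by rewrite !(bformDl, bformDr) !bform_delta sji; field.
  rewrite GE; apply: cvgMr; apply: cvgB; first apply: cvgB; exact: cvgq.
have cvgb u w : (fun K => bform (S K) u w) @ \oo --> bform G u w.
  have -> : (fun K => bform (S K) u w) =
      (fun K => \sum_i \sum_j S K i j * (u 0 i * w 0 j)).
    by apply/funext => K; rewrite bformE.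
  rewrite bformE; apply: cvg_big => [|i _]; first exact: add_continuous.
  apply: cvg_big => [|j _]; first exact: add_continuous.
  by apply: cvgMl; exact: cvgG.
exists G => //; split.
  apply/matrixP => i j; rewrite mxE !GE (addrC (e j)) -!addrA.
  by rewrite (addrC (- l (e j))).
move=> u; apply: (cvgr_to_ge (cvgb u u)); apply: nearW => K.
by have [_] := psdS K.
Qed.

(** A pointwise bounded series of sums of squares of bounded degree has a sum of
    squares as its limit: the bound on the degree makes all Gram matrices live in
    one finite dimensional space, where the positive semidefinite cone is
    closed. *)
Theorem sos_series_limit (s : nat -> seq {mpoly R[n]}) :
  (forall k q, q \in s k -> (msize q <= d)%N) ->
  (forall x, exists C, forall K,
     \sum_(k < K) \sum_(q <- s k) q.@[x] ^+ 2 <= C) ->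
  exists2 S : {mpoly R[n]}, is_sos S & forall x,
    (fun K => \sum_(k < K) \sum_(q <- s k) q.@[x] ^+ 2) @ \oo --> S.@[x].
Proof.
move=> deg_s bnd; pose P k := \sum_(q <- s k) (coef_row q)^T *m coef_row q.
have PE K x : bform (\sum_(k < K) P k) (monom_row x) (monom_row x)
    = \sum_(k < K) \sum_(q <- s k) q.@[x] ^+ 2.
  rewrite -meval_gram_poly (big_morph _ gram_polyD gram_poly0) raddf_sum /=.
  apply: eq_bigr => k _.
  rewrite (big_morph _ gram_polyD gram_poly0) raddf_sum /=.
  apply: eq_big_seq => q sq.
  by rewrite gram_poly_rank1 coef_rowK ?(deg_s k) // rmorphXn.
have psdP k : psd (P k).
  split=> [|u].
    by rewrite raddf_sum; apply: eq_bigr => q _; rewrite /= trmx_mul trmxK.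
  rewrite /P; elim/big_rec: _ => [|q G _ ge0].
    by rewrite /bform mulmx0 mul0mx mxE.
  by rewrite bform_addmx addr_ge0 // bform_rank1 -expr2 sqr_ge0.
have [|G psdG cvgG] := psd_series_cvg psdP.
  by move=> x; have [C leC] := bnd x; exists C => K; rewrite PE.
exists (gram_poly G) => [|x]; first exact: psd_gram_sos.
rewrite meval_gram_poly; have := cvgG (monom_row x) (monom_row x).
by under eq_fun do rewrite PE.
Qed.

End Gram.

(** * Lyapunov functions for linear maps *)

Lemma coord_norm_le (R : realType) (n : nat) (v : 'rV[R]_n) i :
  `|v 0 i| <= `|v|.
Proof.
rewrite [leRHS]/Num.norm /= mx_normrE.
by apply/bigmax_geP; right; exists (0, i).
Qed.

Lemma rV_norm_le (R : realType) (n : nat) (v : 'rV[R]_n) c :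
  0 <= c -> (forall i, `|v 0 i| <= c) -> `|v| <= c.
Proof.
move=> c0 vc; rewrite /Num.norm /= mx_normrE.
apply: bigmax_le => // -[i j] _ /=.
by rewrite ord1.
Qed.

Lemma mulmx_lipschitz (R : realType) (n : nat) (B : 'M[R]_n) :
  exists2 L, 1 <= L & forall v : 'rV[R]_n, `|v *m B| <= L * `|v|.
Proof.
pose L := \sum_i \sum_j `|B i j|.
have L0 : 0 <= L by apply: sumr_ge0 => i _; apply: sumr_ge0.
exists (1 + L) => [|v]; first by rewrite lerDl.
apply: rV_norm_le => [|j]; first by rewrite mulr_ge0 ?addr_ge0.
rewrite mxE (le_trans (ler_norm_sum _ _ _)) // (@le_trans _ _ (L * `|v|)) //.
  rewrite /L big_distrl; apply: ler_sum => i _ /=.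
  rewrite normrM mulrC ler_pM ?coord_norm_le //.
  by rewrite (bigD1 j) //= lerDl sumr_ge0.
by rewrite ler_wpM2r // lerDr.
Qed.

Lemma shell_min (R : realType) (n : nat) (f : 'rV[R]_n -> R) a b :
  continuous f -> (forall v, v != 0 -> 0 < f v) -> 0 < a ->
  exists2 e, 0 < e & forall v, a <= `|v| <= b -> e <= f v.
Proof.
move=> cf pf a0; pose A := [set v : 'rV[R]_n | a <= `|v| <= b].
have [/EVT_min_rV EVT|A0] := pselect (A !=set0); last first.
  by exists 1 => // v vA; case: A0; exists v.
have cA : compact A.
  apply: bounded_closed_compact.
    exists b; split=> [|y lt_by v /= /andP[_ le_vb]]; first exact: num_real.
    exact: le_trans le_vb (ltW lt_by).
  have -> : A = (fun v => `|v|) @^-1` ([set y | a <= y] `&` [set y | y <= b]).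
    by apply/seteqP; split=> v; rewrite /A /=; [case/andP|case=> -> ->].
  apply: preimage_closed; first by move=> v _; exact: norm_continuous.
  by apply: closedI; [exact: closed_ge|exact: closed_le].
have [|c] := EVT f cA; first exact: continuous_subspaceT.
rewrite inE => /andP[ac _] minf; exists (f c).
  by apply: pf; rewrite -normr_gt0 (lt_le_trans a0).
by move=> v vA; apply: minf; rewrite inE.
Qed.

Lemma continuous_at0 (R : realType) (n : nat) (f : 'rV[R]_n -> R) :
  continuous f -> forall e, 0 < e ->
  exists2 r, 0 < r & forall v, `|v| < r -> `|f v - f 0| < e.
Proof.
move=> cf e e0; have /cvgrPdist_lt /(_ e e0) := cf 0.
case/nbhs_ballP => r /= r0 ball_f; exists r => // v vr.
rewrite distrC; apply: ball_f.
by rewrite -ball_normE /= distrC subr0.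
Qed.

Definition row_step (R : realType) (n : nat) (B : 'M[R]_n) (v : 'rV[R]_n) :=
  v *m B.

Lemma iter_mulmxZ (R : realType) (n : nat) (B : 'M[R]_n) t (v : 'rV[R]_n) k :
  iter k (row_step B) (t *: v) = t *: iter k (row_step B) v.
Proof. by elim: k => // k IHk; rewrite !iterS IHk /row_step scalemxAl. Qed.

(** Sublevel sets of [f] need not be bounded. But one step multiplies the norm by
    at most [L], so an orbit cannot jump over the shell between radii [1] and [L],
    where [f] is bounded below: orbits starting near [0] stay in the unit ball.
    There [g] is bounded below away from [0], so an orbit staying away from [0]
    would decrease [f] without bound. Linearity scales the conclusion from small
    vectors to all vectors. *)
Lemma lyapunov_linear (R : realType) (n : nat) (B : 'M[R]_n)
    (f g : 'rV[R]_n -> R) :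
  continuous f -> continuous g -> f 0 = 0 ->
  (forall v, v != 0 -> 0 < f v) -> (forall v, v != 0 -> 0 < g v) ->
  (forall v, f (row_step B v) = f v - g v) ->
  forall v e, 0 < e -> exists k, `|iter k (row_step B) v| < e.
Proof.
move=> cf cg f0 pf pg fB.
have f_ge0 v : 0 <= f v by have [->|/pf/ltW //] := eqVneq v 0; rewrite f0.
have g0 : g 0 = 0 by have := fB 0; rewrite /row_step mul0mx f0; lra.
have g_ge0 v : 0 <= g v by have [->|/pg/ltW //] := eqVneq v 0; rewrite g0.
have [L L1 lipB] := mulmx_lipschitz B.
have [d d0 shell_f] := shell_min L cf pf ltr01.
have [r r0 small_f] := continuous_at0 cf d0.
pose s := Num.min r 1.
have s0 : 0 < s by rewrite lt_min r0 ltr01.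
have trap v k : `|v| < s ->
    `|iter k (row_step B) v| < 1 /\ f (iter k (row_step B) v) < d.
  rewrite lt_min => /andP[vr v1]; elim: k => [|k [IH1 IHd]].
    split=> //; have := small_f v vr.
    by rewrite f0 subr0 => /(le_lt_trans (ler_norm _)).
  rewrite iterS; set w := iter k _ v in IH1 IHd *.
  have fwd : f (row_step B w) < d by rewrite fB; have := g_ge0 w; lra.
  split=> //; rewrite ltNge; apply/negP => w1.
  suff : d <= f (row_step B w) by rewrite leNgt fwd.
  apply: shell_f; rewrite w1 (le_trans (lipB w)) //.
  by rewrite ler_piMr ?(le_trans ler01) // ltW.
have small v e : `|v| < s -> 0 < e -> exists k, `|iter k (row_step B) v| < e.
  move=> vs e0; apply: contrapT => /forallNP far.
  have [d' d'0 shell_g] := shell_min 1 cg pg e0.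
  have g_far k : d' <= g (iter k (row_step B) v).
    apply: shell_g; rewrite leNgt (introN idP (far k)) /=.
    by have [/ltW] := trap v k vs.
  have f_dec k : f (iter k (row_step B) v) <= f v - k%:R * d'.
    elim: k => [|k IHk]; first by rewrite mul0r subr0.
    by rewrite iterS fB -natr1 mulrDl mul1r; have := g_far k; lra.
  have := f_ge0 (iter (Num.bound (f v / d')) (row_step B) v).
  apply/negP; rewrite -ltNge (le_lt_trans (f_dec _)) // subr_lt0.
  by rewrite -ltr_pdivrMr // archi_boundP // divr_ge0 // ltW.
move=> v e e0; pose t := s / (`|v| + 1).
have v1 : 0 < `|v| + 1 by rewrite ltr_wpDl.
have t0 : 0 < t by rewrite divr_gt0.
have [||k] := small (t *: v) (t * e).
- rewrite normrZ gtr0_norm // /t mulrAC ltr_pdivrMr // ltr_pM2l //.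
  by rewrite ltrDl.
- by rewrite mulr_gt0.
by rewrite iter_mulmxZ normrZ gtr0_norm // ltr_pM2l // => ?; exists k.
Qed.

Lemma meval_continuous (R : realType) (n : nat) (p : {mpoly R[n]}) :
  continuous (fun v : 'rV[R]_n => p.@[v 0]).
Proof.
have -> : (fun v : 'rV[R]_n => p.@[v 0]) =
    (fun v => \sum_(m <- msupp p) p@_m * \prod_i v 0 i ^+ m i).
  by apply/funext => v; rewrite mevalE.
apply: continuous_big => [|m _]; first exact: add_continuous.
have cm : continuous (fun w : 'rV[R]_n => \prod_i w 0 i ^+ m i).
  apply: continuous_big => [|i _ w]; first exact: mul_continuous.
  apply: (@continuous_comp _ _ _ (fun w : 'rV[R]_n => w 0 i)
    (fun y => y ^+ m i)).
    exact: coord_continuous.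
  exact: exprn_continuous.
by move=> v; apply: continuousM; [exact: cst_continuous|exact: cm].
Qed.

Lemma continuous_ge0_at0 (R : realType) (n : nat) (f : 'rV[R]_n -> R) :
  (0 < n)%N -> continuous f -> (forall v, v != 0 -> 0 < f v) -> 0 <= f 0.
Proof.
case: n f => // n f _ cf pf; rewrite leNgt; apply/negP => f0_lt0.
have [|r r0 near0] := continuous_at0 cf (e := - f 0); first by rewrite oppr_gt0.
have v0 : const_mx 1 != 0 :> 'rV[R]_n.+1.
  by apply/eqP => /rowP/(_ ord0); rewrite !mxE => /eqP; rewrite oner_eq0.
pose t := r / 2 / `|const_mx 1 : 'rV[R]_n.+1|.
have t0 : 0 < t by rewrite !divr_gt0 // normr_gt0.
have := near0 (t *: const_mx 1).
have := pf (t *: const_mx 1).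
rewrite scaler_eq0 negb_or v0 gt_eqF // => /(_ isT).
rewrite normrZ gtr0_norm // /t divfK ?normr_eq0 // => ft.
rewrite ltr_pdivrMr // mulr_natr mulr2n ltrDl r0 => /(_ isT).
by have := ler_norm (f (t *: const_mx 1) - f 0); lra.
Qed.

(** * Summing along the orbits of the dynamics *)

Section Orbit.
Variables (R : realType) (n : nat) (A : 'M[R]_n).

Lemma mpoly_fun_iter_lin k (q : {mpoly R[n]}) x :
  mpoly_fun (iter k (mpoly_lin A) q) x = mpoly_fun q (iter k (mulmx A) x).
Proof. by elim: k x => // k IHk x; rewrite iterS mpoly_fun_lin IHk -iterSr. Qed.

Lemma msize_iter_lin k (q : {mpoly R[n]}) :
  (msize (iter k (mpoly_lin A) q) <= msize q)%N.
Proof. by elim: k => // k IHk; apply: leq_trans (msize_lin _ _) IHk. Qed.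

Lemma mpoly_fun_tr (p : {mpoly R[n]}) (v : 'rV[R]_n) :
  mpoly_fun p v^T = p.@[v 0].
Proof. by apply: meval_eq => i; rewrite mxE. Qed.

Lemma tr_iter k (v : 'rV[R]_n) :
  (iter k (row_step A^T) v)^T = iter k (mulmx A) v^T.
Proof. by elim: k => // k IHk; rewrite !iterS /row_step trmx_mul trmxK IHk. Qed.

Lemma mpoly_fun_ge0 (V : {mpoly R[n]}) : (0 < n)%N ->
  positive_definite (mpoly_fun V) -> forall x, 0 <= mpoly_fun V x.
Proof.
move=> n0 pV x; rewrite -[x]trmxK mpoly_fun_tr.
have [->|x0] := eqVneq x^T 0; last first.
  by rewrite -mpoly_fun_tr; apply/ltW/pV; rewrite trmx_eq0 // trmx_eq0.
apply: (continuous_ge0_at0 (f := fun v : 'rV[R]_n => V.@[v 0]) n0).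
  exact: meval_continuous.
by move=> v v0; rewrite -mpoly_fun_tr pV // trmx_eq0.
Qed.

(** The partial sums telescope to [V x - V (A ^ K x)], so they are bounded by
    [V x], and composing with [A] does not raise the degree. *)
Lemma orbit_sos (V W : {mpoly R[n]}) :
  is_sos W -> (forall x, 0 <= mpoly_fun V x) ->
  (forall x, mpoly_fun W x = mpoly_fun V x - mpoly_fun V (A *m x)) ->
  exists2 S : {mpoly R[n]}, is_sos S & forall x,
    (fun K => \sum_(k < K) mpoly_fun W (iter k (mulmx A) x)) @ \oo
      --> mpoly_fun S x.
Proof.
move=> [s Ws] V0 WV.
pose sk k := [seq iter k (mpoly_lin A) q | q <- s].
have skE k (x : 'cV[R]_n) : \sum_(q <- sk k) q.@[fun i => x i 0] ^+ 2
    = mpoly_fun W (iter k (mulmx A) x).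
  rewrite big_map Ws /mpoly_fun raddf_sum; apply: eq_bigr => q _ /=.
  by rewrite rmorphXn; congr (_ ^+ 2); apply: mpoly_fun_iter_lin.
have [||S sosS cvgS] := @sos_series_limit R n (\max_(q <- s) msize q) sk.
- move=> k _ /mapP[q qs ->]; apply: leq_trans (msize_iter_lin _ _) _.
  exact: leq_bigmax_seq.
- move=> v; exists (mpoly_fun V (\col_i v i)) => K.
  set x : 'cV[R]_n := \col_i v i.
  have vE : v =1 (fun i => x i 0) by move=> i; rewrite mxE.
  under eq_bigr do under eq_bigr do rewrite (meval_eq _ vE).
  under eq_bigr do rewrite skE.
  have -> : \sum_(k < K) mpoly_fun W (iter k (mulmx A) x)
      = mpoly_fun V x - mpoly_fun V (iter K (mulmx A) x).
    elim: K => [|K IHK]; first by rewrite big_ord0 subrr.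
    by rewrite big_ord_recr /= IHK WV addrA subrK.
  by rewrite gerBl.
exists S => // x; have := cvgS (fun i => x i 0).
by under eq_fun do under eq_bigr do rewrite skE.
Qed.

End Orbit.

Theorem proposition3p10 (R : realType) (n : nat) (n_gt0 : (0 < n)%N)
    (A : 'M[R]_n) (V : {mpoly R[n]}) :
  positive_definite (mpoly_fun V) ->
  positive_definite (fun x : 'cV[R]_n => mpoly_fun V x - mpoly_fun V (A *m x)) ->
  is_sos (V - mpoly_lin A V) ->
  is_sos V.
Proof.
move=> pV pW sosW; set W := V - mpoly_lin A V in sosW.
have WE x : mpoly_fun W x = mpoly_fun V x - mpoly_fun V (A *m x).
  by rewrite -mpoly_fun_lin /mpoly_fun mevalB.
have V0 := mpoly_fun_ge0 n_gt0 pV.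
have [S sosS cvgS] := orbit_sos sosW V0 WE.
have W0 x : 0 <= mpoly_fun W x.
  have [->|/pW] := eqVneq x 0; first by rewrite WE mulmx0 subrr.
  by rewrite -WE => /ltW.
have S0 x : 0 <= mpoly_fun S x.
  by apply: (cvgr_to_ge (cvgS x)); apply: nearW => K; apply: sumr_ge0.
(* Dropping the first term of the series shifts the orbit by one step. *)
have SA x : mpoly_fun S (A *m x) = mpoly_fun S x - mpoly_fun W x.
  suff cvgSA : (fun K => \sum_(k < K) mpoly_fun W (iter k (mulmx A) x)) @ \oo
      --> mpoly_fun S (A *m x) + mpoly_fun W x.
    by rewrite (cvg_unique _ (cvgS x) cvgSA) // addrK.
  rewrite -cvg_shiftS.
  under eq_fun do rewrite big_ord_recl /= addrC.
  apply: cvgD; last exact: cvg_cst.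
  by under eq_fun do under eq_bigr do rewrite -iterS iterSr; exact: cvgS.
have S_0 : mpoly_fun S 0 = 0.
  have W00 k : mpoly_fun W (iter k (mulmx A) 0) = 0.
    by elim: k => [|k IHk]; rewrite ?iterSr ?mulmx0 // WE mulmx0 subrr.
  have := cvgS 0; under eq_fun do under eq_bigr do rewrite W00.
  under eq_fun do rewrite big1 //.
  by move=> /(cvg_unique _)/(_ (cvg_cst 0)) <-.
have conv v e : 0 < e -> exists k, `|iter k (row_step A^T) v| < e.
  apply: (@lyapunov_linear R n A^T (fun v => S.@[v 0]) (fun v => W.@[v 0])).
  - exact: meval_continuous.
  - exact: meval_continuous.
  - by rewrite -mpoly_fun_tr trmx0.
  - move=> w w0; rewrite -mpoly_fun_tr.
    have := S0 (A *m w^T); have := pW w^T; rewrite trmx_eq0 => /(_ w0).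
    by rewrite SA WE; lra.
  - by move=> w w0; rewrite -mpoly_fun_tr WE; apply: pW; rewrite trmx_eq0.
  - by move=> w; rewrite -!mpoly_fun_tr /row_step trmx_mul trmxK SA.
(* [V] and [S] drop by the same amount at each step. *)
pose h := V - S.
have hE x : mpoly_fun h x = mpoly_fun V x - mpoly_fun S x.
  by rewrite /mpoly_fun mevalB.
have h_iter k x : mpoly_fun h (iter k (mulmx A) x) = mpoly_fun h x.
  by elim: k => // k IHk; rewrite iterS -IHk !hE SA WE; ring.
(* [h] is invariant along the orbit of [x], which comes arbitrarily close
   to [0]. *)
have h_cst x : mpoly_fun h x = mpoly_fun h 0.
  apply/eqP; rewrite -subr_eq0 -normr_eq0; apply/negPn/negP => dist_neq0.
  have dist_gt0 : 0 < `|mpoly_fun h x - mpoly_fun h 0|.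
    by rewrite lt0r dist_neq0 normr_ge0.
  have [r r0 near0] := continuous_at0 (@meval_continuous _ _ h) dist_gt0.
  have [k /near0] := conv x^T r r0.
  by rewrite -!mpoly_fun_tr tr_iter trmxK trmx0 h_iter ltxx.
pose c := mpoly_fun V 0.
have VE x : mpoly_fun V x = mpoly_fun S x + c.
  by have := h_cst x; rewrite !hE S_0 subr0 -/c => <-; rewrite addrC subrK.
have -> : V = S + c%:MP.
  by apply: mpoly_eq_fun => x; rewrite VE /mpoly_fun mevalD mevalC.
case: sosS => s ->; exists ((Num.sqrt c)%:MP :: s).
by rewrite big_cons addrC -rmorphXn sqr_sqrtr //; exact: V0.
Qed.
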